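(* Let $1\le m\le n$ and consider the polynomial $p(z)=1-m^{m/2}z_1\cdots z_m$ on $\mathbb C^n$. Then $p$ is cyclic in $D_\alpha(\mathbb B_n)$ whenever $\alpha\le\frac{2n+1-m}{2}$.
   Context: $\mathbb B_n$ is the Euclidean unit ball of $\mathbb C^n$. For $\alpha\in\mathbb R$, the Dirichlet-type space $D_\alpha(\mathbb B_n)$ is the Hilbert space of all holomorphic $f(z)=\sum_k a_kz^k$ on $\mathbb B_n$ (sum over multi-indices $k$ of non-negative integers, $|k|=k_1+\dots+k_n$, $k!=k_1!\cdots k_n!$) with $$\|f\|_\alpha^2:=\sum_{k}(n+|k|)^\alpha\frac{(n-1)!\,k!}{(n-1+|k|)!}|a_k|^2<\infty .$$ A function $f\in D_\alpha(\mathbb B_n)$ is cyclic if the closed linear span in $D_\alpha(\mathbb B_n)$ of $\{z_1^{k_1}\cdots z_n^{k_n}f: k_1,\dots,k_n=0,1,\dots\}$ equals $D_\alpha(\mathbb B_n)$. *)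

(* Defs.v *)
From HB Require Import structures.
From mathcomp Require Import all_boot all_order all_algebra.
From mathcomp Require Import complex.
From mathcomp Require Import all_classical all_reals all_analysis.
From mathcomp Require summability.
Set Implicit Arguments.
Unset Strict Implicit.
Unset Printing Implicit Defensive.
Import Order.TTheory GRing.Theory Num.Theory.
Import numFieldNormedType.Exports.
Local Open Scope ring_scope.
Local Open Scope classical_set_scope.
Local Open Scope complex_scope.

(* The regular algebra [R[i]^o] is only used to give access to the topology of
   the complex field [R[i]]; the two types are convertible. *)

Section DirichletSpace.
Variables (R : realType) (n : nat).

Definition multi_index := {ffun 'I_n -> nat}.

Definition mdeg (k : multi_index) : nat := (\sum_i k i)%N.

Definition mfact (k : multi_index) : nat := (\prod_i (k i)`!)%N.

Definition monom (k : multi_index) (z : 'rV[R[i]]_n) : R[i] :=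
  \prod_i z 0 i ^+ k i.

(* Euclidean ball; the normed structure of the library on ['rV_n] is the sup
   norm, which induces the same topology but a different ball. *)
Definition eball : set 'rV[R[i]]_n :=
  [set z | \sum_i (Normc.normc (z 0 i)) ^+ 2 < 1].

Definition holomorphic_on_ball (f : 'rV[R[i]]_n -> R[i]^o) : Prop :=
  forall z : 'rV[R[i]^o]_n, eball z -> differentiable f z.

(* [f z = \sum_k a_k z^k] on the ball, the sum over multi-indices being the
   limit along the net of finite sets of multi-indices. The family [a] is
   determined by the values of [f] on the ball. *)
Definition power_series_of (f : 'rV[R[i]]_n -> R[i]^o)
    (a : multi_index -> R[i]) : Prop :=
  forall z, eball z ->
    summability.partial_sum (fun k => a k * monom k z : R[i]^o)
      @ summability.totally --> f z.

(* Squared norm of order [alpha], as a function of the coefficients. *)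
Definition dirichlet_norm2 (alpha : R) (a : multi_index -> R[i]) : \bar R :=
  (\esum_(k in [set: multi_index])
     ((n + mdeg k)%:R `^ alpha
       * ((n.-1)`! * mfact k)%:R / ((n.-1 + mdeg k)`!)%:R
       * Normc.normc (a k) ^+ 2)%:E)%E.

(* Functions are total on ['rV_n], but membership in the sets below only
   depends on their restriction to the ball. *)
Definition dirichlet (alpha : R) : set ('rV[R[i]]_n -> R[i]^o) :=
  [set f | holomorphic_on_ball f /\
    exists a, power_series_of f a /\ (dirichlet_norm2 alpha a < +oo)%E].

Definition shift_span (f : 'rV[R[i]]_n -> R[i]^o) :
    set ('rV[R[i]]_n -> R[i]^o) :=
  [set h | exists s : seq (R[i] * multi_index),
    h = fun z => \sum_(ck <- s) ck.1 * (monom ck.2 z * f z)].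

Definition dirichlet_closure (alpha : R) (S : set ('rV[R[i]]_n -> R[i]^o)) :
    set ('rV[R[i]]_n -> R[i]^o) :=
  [set g | dirichlet alpha g /\ forall e : R, 0 < e ->
    exists2 h, S h &
      exists a, power_series_of (fun z => g z - h z) a /\
        (dirichlet_norm2 alpha a < (e ^+ 2)%:E)%E].

Definition cyclic_vector (alpha : R) (f : 'rV[R[i]]_n -> R[i]^o) : Prop :=
  dirichlet alpha f /\
  dirichlet_closure alpha (shift_span f) = dirichlet alpha.

End DirichletSpace.

(* Main.v *)
Require Import Defs.
From mathcomp Require Import all_boot all_order all_algebra.
From mathcomp Require Import complex.
From mathcomp Require Import all_classical all_reals all_analysis.
From mathcomp Require summability.
From mathcomp Require Import finmap zify ring lra.

(** Write [x = c z_1 ... z_m] with [c = m^(m/2)], so that [p = 1 - x], and let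
[u] be the exponent of [z_1 ... z_m]. For a polynomial [P] in one variable
with [P(1) = 1], [1 - P(x)] is divisible by [1 - x]; hence, for every
multi-index [k], [z^k - z^k P(x)] is a polynomial multiple of [p]
([telescope_in_span]). To approximate [z^k] by multiples of [p] it is enough to
make the norm of [z^k P(x)] small. If [P = sum_j lam_j x^j], the monomials
[z^(k + j u)] are orthogonal, and the squared norm of [z^k P(x)] is
[sum_j lam_j^2 W_j] with [W_j = c^(2j) w(k + j u)], where [w(k)] is the squared
norm of [z^k]. Under the constraint [sum_j lam_j = 1] the infimum of such sums
is [1 / sum_j 1/W_j], which tends to [0] with the degree as soon as
[W_j = O(j + 1)], by divergence of the harmonic series: [lam_j] proportional to
[1 / (j + 1)] will do ([approximable_monom]).

The bound [W_j = O(j + 1)] is where [alpha] enters. As [w] increases with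
[alpha], it suffices to treat [alpha = (2n + 1 - m)/2], which is positive. Each
coordinate shift is bounded on the space for [alpha >= 0], whence
[w(k + j u) <= L w(j u)] ([weightD]), and only [k = 0] is left. There
[W_j = m^(mj) (n + mj)^alpha (n-1)! (j!)^m / (n - 1 + mj)!], and Stirling's
formula gives [m^(mj) (j!)^m / (mj)! ~ C j^((m-1)/2)] and
[W_j ~ C j^(alpha - (2n - 1 - m)/2)], an exponent of at most [1]. The upper
bound alone has an elementary proof by induction on [j]
([multinomial_ratio_bound]).

Every function of the space is approximated by finite combinations of
monomials ([truncation]), so approximating all monomials is enough. The
argument takes place in the space of coefficient families; only the last part
returns to functions on the ball ([cyclic_of_approximable]). *)

Set Implicit Arguments.
Unset Strict Implicit.
Unset Printing Implicit Defensive.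
Import Order.TTheory GRing.Theory Num.Theory.
Import numFieldNormedType.Exports.

(** * Growth of the inverse multinomial coefficients *)

(** The factors of indices [s] and [m - 1 - s] multiply to
[(x + a)(x + m + 1 - a) >= x (x + m + 1)], with [a = s + 1]. *)
Lemma reflected_prod_ge x m : (x * (x + m.+1)) ^ m <= (\prod_(s < m) (x + s.+1)) ^ 2.
Proof.
rewrite -mulnn [X in _ <= _ * X](reindex_inj rev_ord_inj) -big_split /=.
rewrite -[X in _ ^ X]card_ord -prod_nat_const.
by apply: leq_prod => s _; have := ltn_ord s; nia.
Qed.

Lemma fact_addn x m : (x + m)`! = x`! * \prod_(s < m) (x + s.+1).
Proof.
elim: m => [|m IH]; first by rewrite addn0 big_ord0 muln1.
by rewrite addnS factS IH big_ord_recr /= addnS mulnCA [X in _ * X]mulnC.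
Qed.

(** With [q = m + 1] this says that [A_j = q^(qj) (j!)^q / (qj)!] satisfies
[A_j^2 <= q^(2q) j^(q-1)], the growth given by Stirling's formula up to the
constant. From [j] to [j + 1], [A_j] is multiplied by the product over
[1 <= s <= q - 1] of [q (j+1) / (qj + s)], whose square is at most
[((j + 1) / j)^(q-1)] once [s] is paired with [q - s]. *)
Lemma multinomial_ratio_bound m j : 0 < j ->
  (m.+1 ^ (m.+1 * j) * j`! ^ m.+1) ^ 2 <=
    (m.+1 ^ m.+1) ^ 2 * j ^ m * ((m.+1 * j)`!) ^ 2.
Proof.
case: j => // j _; elim: j => [|j IH].
  rewrite muln1 (_ : 1`! = 1) // !exp1n !muln1 leq_pmulr // expn_gt0 fact_gt0 //.
set J := j.+1 in IH *; set A := m.+1 ^ (m.+1 * J) * _ in IH.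
set B := (m.+1 * J)`! in IH.
have -> : m.+1 ^ (m.+1 * J.+1) * J.+1`! ^ m.+1 = A * (m.+1 * J.+1) ^ m.+1.
  rewrite factS [(m.+1 * J.+1)%N in LHS]mulnS expnD [in LHS]expnMn.
  by rewrite [in RHS]expnMn mulnACA [RHS]mulnC.
set Q := \prod_(s < m) (m.+1 * J + s.+1).
have -> : (m.+1 * J.+1)`! = B * (Q * (m.+1 * J.+1)).
  by rewrite mulnS addnC fact_addn big_ord_recr /= -/Q -/B.
have HQ := reflected_prod_ge (m.+1 * J) m; rewrite -/Q in HQ.
set M := m.+1 ^ m.+1 in IH *; set y := m.+1 * J.+1.
suff H : J ^ m * (y ^ m.+1) ^ 2 <= J.+1 ^ m * (Q * y) ^ 2.
  rewrite -(leq_pmul2l (m := J ^ m)) ?expn_gt0 //.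
  apply: (@leq_trans (A ^ 2 * (J.+1 ^ m * (Q * y) ^ 2))).
    by rewrite expnMn mulnCA leq_mul2l H orbT.
  apply: (@leq_trans ((M ^ 2 * J ^ m * B ^ 2) * (J.+1 ^ m * (Q * y) ^ 2))).
    by rewrite leq_mul2r IH orbT.
  by apply: eq_leq; ring.
have -> : J ^ m * (y ^ m.+1) ^ 2 =
    J.+1 ^ m * ((m.+1 * J * (m.+1 * J + m.+1)) ^ m * y ^ 2).
  have -> : m.+1 * J + m.+1 = y by rewrite /y mulnS addnC.
  by rewrite [y ^ m.+1]expnS /y !expnMn; ring.
by rewrite leq_mul2l [(Q * y) ^ 2]expnMn leq_mul2r HQ !orbT.
Qed.

(** The square of the bound on [q^(qj) w(j u)], [q = m + 1], needed for
[alpha = (2n - m)/2], cleared of denominators: squaring makes the exponent of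
[n + qj] an integer. Since [(n - 1 + qj)! >= (qj)! (qj + 1)^(n-1)] and
[n + qj <= n (qj + 1)], the powers of [qj + 1] add up to
[m + (2n - m) = 2 + 2 (n - 1)]. *)
Lemma nat_weight_bound n m j : 0 < n -> m.+1 <= n ->
  (m.+1 ^ (m.+1 * j) * j`! ^ m.+1) ^ 2 * (n + m.+1 * j) ^ (2 * n - m) *
    (n.-1)`! ^ 2 <=
  (m.+1 ^ m.+1 * n ^ (2 * n - m) * (n.-1)`! * (m.+1 * j).+1 *
   (n.-1 + m.+1 * j)`!) ^ 2.
Proof.
move=> n_gt0 le_mn; set y := m.+1 * j; set M := m.+1 ^ m.+1.
set A := _ ^ y * _; set e := 2 * n - m; set d := (n.-1)`!.
set B := y`!; set G := (_ + y)`!.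
have le_A : A ^ 2 <= M ^ 2 * y.+1 ^ m * B ^ 2.
  have [j0|j_gt0] := posnP j.
    by rewrite /A /B /y j0 muln0 exp1n mul1n !exp1n !muln1 expn_gt0 /M expn_gt0.
  apply: leq_trans (multinomial_ratio_bound _ j_gt0) _.
  rewrite leq_mul2r leq_mul2l; apply/orP; right; apply/orP; right.
  have [->//|m_gt0] := posnP m.
  rewrite leq_exp2r // /y; nia.
have le_N : (n + y) ^ e <= n ^ e * y.+1 ^ e.
  rewrite -expnMn leq_exp2r ?subn_gt0; nia.
have le_G : B * y.+1 ^ n.-1 <= G.
  rewrite /G addnC fact_addn leq_mul2l -[X in _ ^ X]card_ord -prod_nat_const.
  by apply/orP; right; apply: leq_prod => i _; lia.
have le_ne : n ^ e <= (n ^ e) ^ 2.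
  by rewrite -mulnn leq_pmulr // expn_gt0 n_gt0.
apply: (@leq_trans (M ^ 2 * y.+1 ^ m * B ^ 2 * (n ^ e * y.+1 ^ e) * d ^ 2)).
  by rewrite leq_mul2r leq_mul ?orbT.
apply: (@leq_trans (M ^ 2 * n ^ e * d ^ 2 * y.+1 ^ 2 * (B * y.+1 ^ n.-1) ^ 2)).
  apply: eq_leq; rewrite expnMn -expnM.
  have -> : M ^ 2 * y.+1 ^ m * B ^ 2 * (n ^ e * y.+1 ^ e) * d ^ 2 =
     M ^ 2 * B ^ 2 * n ^ e * d ^ 2 * y.+1 ^ (m + e) by rewrite expnD; ring.
  have -> : m + e = 2 + n.-1 * 2 by lia.
  by rewrite expnD; ring.
rewrite !expnMn; apply: leq_mul; last by rewrite -expnMn leq_exp2r.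
by rewrite !leq_mul.
Qed.

Local Open Scope ring_scope.
Local Open Scope complex_scope.

(** * Squared norms of the monomials *)

Section Weights.
Variables (R : realType) (n : nat) (alpha : R).
Local Notation MI := (multi_index n).

Definition weight (k : MI) : R :=
  (n + mdeg k)%:R `^ alpha * ((n.-1)`! * mfact k)%:R / ((n.-1 + mdeg k)`!)%:R.

Lemma weight_ge0 k : 0 <= weight k.
Proof. by rewrite !mulr_ge0 ?invr_ge0 ?powR_ge0. Qed.

Lemma mdegD (k l : MI) : mdeg (k + l) = (mdeg k + mdeg l)%N.
Proof. by rewrite /mdeg -big_split; apply: eq_bigr => i _; rewrite ffunE. Qed.

Definition unit_index (i : 'I_n) : MI := [ffun j => (j == i : nat)].

Lemma mdeg_unit i : mdeg (unit_index i) = 1%N.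
Proof.
rewrite /mdeg (bigD1 i) //= ffunE eqxx big1 // => j /negbTE ne_ji.
by rewrite ffunE ne_ji.
Qed.

Lemma mfactD_unit (l : MI) i : mfact (l + unit_index i) = ((l i).+1 * mfact l)%N.
Proof.
rewrite /mfact (bigD1 i) //= [in RHS](bigD1 i) //= mulnA !ffunE eqxx.
congr (_ * _)%N; first by rewrite /GRing.add /= addn1 factS.
by apply: eq_bigr => j /negbTE ne_ji; rewrite !ffunE ne_ji /GRing.add /= addn0.
Qed.

Lemma index_sum_units (k : MI) : k = \sum_i unit_index i *+ k i.
Proof.
apply/ffunP => j; rewrite sum_ffunE (bigD1 j) //= ffunMnE ffunE eqxx big1.
  by rewrite addr0 -mulr_natr mul1r natn.
by move=> i; rewrite eq_sym => /negbTE ne; rewrite ffunMnE ffunE ne mul0rn.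
Qed.

(** Multiplication by a coordinate is bounded on the space: as
[l_i + 1 <= n + |l|], the factorials do not increase, and [n + |l|] is at most
doubled. *)
Lemma weightD_unit l i : (0 < n)%N -> 0 <= alpha ->
  weight (l + unit_index i) <= 2 `^ alpha * weight l.
Proof.
move=> n_gt0 alpha_ge0.
have le_deg : (l i <= mdeg l)%N by rewrite /mdeg (bigD1 i) //= leq_addr.
rewrite /weight mdegD mdeg_unit mfactD_unit.
have -> : (n.-1 + (mdeg l + 1))%N = (n.-1 + mdeg l).+1 by lia.
rewrite factS.
have -> : (n.-1 + mdeg l).+1 = (n + mdeg l)%N by lia.
set x := (n + mdeg l)%N; set f := (_ + _)`!.
have x_gt0 : (0 < x)%N by lia.
have le_pow : (n + (mdeg l + 1))%:R `^ alpha <= 2 `^ alpha * x%:R `^ alpha.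
  rewrite -powRM ?ler0n // -natrM ge0_ler_powR ?nnegrE ?ler0n // ler_nat; lia.
have le_frac : (n.-1`! * ((l i).+1 * mfact l))%:R / (x * f)%:R <=
    (n.-1`! * mfact l)%:R / f%:R :> R.
  have f_neq0 : f%:R != 0 :> R by rewrite pnatr_eq0 -lt0n fact_gt0.
  rewrite ler_pdivrMr ?ltr0n ?muln_gt0 ?x_gt0 ?fact_gt0 //.
  have -> : (n.-1`! * mfact l)%:R / f%:R * (x * f)%:R =
      (n.-1`! * mfact l * x)%:R :> R by rewrite !natrM; field.
  rewrite ler_nat mulnCA [leqRHS]mulnC leq_mul2r; lia.
by rewrite -!mulrA (mulrA (2 `^ _)) ler_pM ?powR_ge0 // divr_ge0.
Qed.

Lemma weightD (k : MI) : (0 < n)%N -> 0 <= alpha ->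
  exists2 K, 0 <= K & forall l, weight (l + k) <= K * weight l.
Proof.
move=> n_gt0 alpha_ge0.
pose bounded (k : MI) :=
  exists2 K, 0 <= K & forall l, weight (l + k) <= K * weight l.
have bounded0 : bounded 0 by exists 1 => // l; rewrite addr0 mul1r.
have boundedD k1 k2 : bounded k1 -> bounded k2 -> bounded (k1 + k2).
  move=> [K1 K1_ge0 le1] [K2 K2_ge0 le2]; exists (K2 * K1) => [|l].
    exact: mulr_ge0.
  by rewrite addrA (le_trans (le2 _)) // -mulrA ler_wpM2l.
rewrite [k]index_sum_units; apply: (big_ind bounded) => // i _.
elim: (k i) => [|t IHt]; first by rewrite mulr0n.
rewrite mulrSr; apply: boundedD => //.
by exists (2 `^ alpha) => [|l]; [exact: powR_ge0 | exact: weightD_unit].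
Qed.

End Weights.

Lemma le_weight (R : realType) (n : nat) (alpha beta : R) (k : multi_index n) :
  (0 < n)%N -> alpha <= beta -> weight alpha k <= weight beta k.
Proof.
move=> n_gt0 le_ab; rewrite /weight !ler_wpM2r ?invr_ge0 ?ler0n //.
by rewrite ler_powR // ler1n; lia.
Qed.

Section FirstUnits.
Variable n : nat.
Local Notation MI := (multi_index n).

Definition first_units m : MI := [ffun i : 'I_n => (i < m : nat)%N].

Lemma mdeg_first_units m j : (m <= n)%N -> mdeg (first_units m *+ j) = (m * j)%N.
Proof.
move=> le_mn; rewrite /mdeg (eq_bigr (fun i : 'I_n => (i < m)%N * j)%N).
  rewrite -big_distrl -big_mkcond /= sum1_card; congr (_ * _)%N.
  by rewrite -sum1_card -(big_ord_widen n (fun=> 1%N)) // sum1_card card_ord.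
by move=> i _; rewrite ffunMnE ffunE -mulr_natr natn.
Qed.

Lemma mfact_first_units m j : (m <= n)%N -> mfact (first_units m *+ j) = (j`! ^ m)%N.
Proof.
move=> le_mn; rewrite /mfact (eq_bigr (fun i : 'I_n => if (i < m)%N then j`! else 1%N)).
  rewrite -big_mkcond /= -(big_ord_widen n (fun=> j`!)) // prod_nat_const.
  by rewrite card_ord.
move=> i _; rewrite ffunMnE ffunE -mulr_natr natn.
by case: ifP => _; rewrite /GRing.mul /= ?mul1n ?mul0n.
Qed.

End FirstUnits.

(** This is [W_j = O(j + 1)] for [k = 0] and the largest admissible [alpha],
the number of variables in the product being [m + 1]. *)
Lemma weight_diagonal_bound (R : realType) (n m : nat) : (m < n)%N ->
  exists2 K : R, 0 <= K &
  forall j, (m.+1 ^ m.+1)%:R ^+ j *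
      weight ((2 * n%:R - m%:R) / 2) (first_units n m.+1 *+ j) <= K * j.+1%:R.
Proof.
move=> lt_mn; have n_gt0 : (0 < n)%N by lia.
pose Kn := (m.+1 ^ m.+1 * n ^ (2 * n - m) * (n.-1)`!)%N.
exists (Kn * m.+1)%:R => // j.
rewrite /weight mdeg_first_units // mfact_first_units //.
set y := (m.+1 * j)%N; set G := (_ + y)`!; set P := _ `^ _.
have P2 : P ^+ 2 = ((n + y) ^ (2 * n - m))%:R.
  rewrite -powR_mulrn ?powR_ge0 // -powRrM natrX -powR_mulrn ?ler0n //.
  by rewrite mulfVK ?pnatr_eq0 // natrB ?natrM //; lia.
have P_ge0 : 0 <= P by exact: powR_ge0.
apply: (@le_trans _ _ (Kn * y.+1)%:R); last first.
  by rewrite -natrM ler_nat -mulnA leq_mul2l; apply/orP; right; rewrite /y; lia.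
have G_gt0 : 0 < G%:R :> R by rewrite ltr0n fact_gt0.
rewrite !mulrA ler_pdivrMr // -natrX -expnM.
rewrite -(@ler_pXn2r _ 2) // ?nnegrE ?mulr_ge0 ?ler0n //.
have -> : ((m.+1 ^ (m.+1 * j))%:R * P * (n.-1`! * j`! ^ m.+1)%:R) ^+ 2 =
   ((m.+1 ^ (m.+1 * j) * j`! ^ m.+1) ^ 2 * (n.-1)`! ^ 2)%:R * P ^+ 2.
  by rewrite !(natrM, natrX); ring.
rewrite P2 -!natrM -natrX ler_nat.
by apply: leq_trans (nat_weight_bound j n_gt0 lt_mn); rewrite mulnAC.
Qed.

(** * The weighted space of coefficient families *)

Section Coefficients.
Local Open Scope classical_set_scope.
Variables (R : realType) (n : nat) (alpha : R).
Local Notation MI := (multi_index n).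
Local Notation family := (MI -> R[i]).
Local Notation N2 := (@dirichlet_norm2 R n alpha).

Definition monom_coef (k : MI) : family := fun l => (l == k)%:R.

Lemma normcD2 (x y : R[i]) :
  Normc.normc (x + y) ^+ 2 <= 2 * Normc.normc x ^+ 2 + 2 * Normc.normc y ^+ 2.
Proof.
have normc_ge0 (z : R[i]) : 0 <= Normc.normc z by case: z => a b; exact: sqrtr_ge0.
set a := Normc.normc x; set b := Normc.normc y.
apply: (@le_trans _ _ ((a + b) ^+ 2)).
  by rewrite ler_pXn2r ?nnegrE ?addr_ge0 ?normc_ge0 //; exact: le_normcD.
by rewrite -subr_ge0 (_ : _ - _ = (a - b) ^+ 2) ?sqr_ge0 //; ring.
Qed.

Lemma norm2_term_ge0 (a : family) k :
  (0 <= (weight alpha k * Normc.normc (a k) ^+ 2)%:E)%E.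
Proof. by rewrite lee_fin mulr_ge0 ?weight_ge0 ?sqr_ge0. Qed.

Lemma norm2_ge0 (a : family) : (0 <= N2 a)%E.
Proof. by apply: esum_ge0 => k _; exact: norm2_term_ge0. Qed.

(** This weak form of the triangle inequality is enough for approximation
arguments and follows termwise from [|x + y|^2 <= 2 |x|^2 + 2 |y|^2]; each factor
[2] is written as a sum, so that additivity of sums of nonnegative families
suffices. *)
Lemma norm2D (a b : family) : (N2 (a + b)%R <= N2 a + N2 a + (N2 b + N2 b))%E.
Proof.
rewrite /dirichlet_norm2 -!esumD;
  try by move=> k _; rewrite ?adde_ge0 // norm2_term_ge0.
apply: le_esum => k _; rewrite -!EFinD lee_fin -!mulrDr ler_wpM2l ?weight_ge0 //.
by apply: le_trans (normcD2 _ _) _; lra.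
Qed.

Lemma norm2D_disjoint (a b : family) : (forall k, a k = 0 \/ b k = 0) ->
  N2 (a + b) = (N2 a + N2 b)%E.
Proof.
move=> dis; rewrite /dirichlet_norm2 -esumD; try by move=> k _; exact: norm2_term_ge0.
apply: eq_esum => k _; rewrite -EFinD -mulrDr fctE.
by case: (dis k) => ->; rewrite Normc.normc0 ?(add0r, addr0) expr0n /= ?(add0r, addr0).
Qed.

Lemma norm2_monom c k :
  N2 (c *: monom_coef k) = (weight alpha k * Normc.normc c ^+ 2)%:E.
Proof.
pose f l := (weight alpha l * Normc.normc ((c *: monom_coef k) l) ^+ 2)%:E.
have -> : N2 (c *: monom_coef k) = (\esum_(l in [set k]) f l)%E.
  rewrite esum_mkcond; apply: eq_esum => l _; rewrite /f.
  case: ifPn => [//|]; rewrite notin_setE /= => /eqP/negbTE ne_lk.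
  by rewrite fctE /monom_coef ne_lk scaler0 Normc.normc0 expr0n mulr0.
rewrite esum_set1; last exact: norm2_term_ge0.
by rewrite /f fctE /monom_coef eqxx -mulr_algl mulr1 /GRing.scale /= mulr1.
Qed.

Lemma norm2_0 : N2 0 = 0%E.
Proof.
apply: esum1 => k _.
by rewrite [X in Normc.normc X](_ : _ = 0) ?Normc.normc0 ?expr0n ?mulr0.
Qed.

Lemma norm2_sum_monom (kap : nat -> MI) (c : nat -> R[i]) N : injective kap ->
  N2 (\sum_(j < N) c j *: monom_coef (kap j)) =
  (\sum_(j < N) weight alpha (kap j) * Normc.normc (c j) ^+ 2)%:E.
Proof.
move=> kapI; elim: N => [|N IH]; first by rewrite !big_ord0 norm2_0.
rewrite !big_ord_recr /= norm2D_disjoint ?IH ?norm2_monom //= => l.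
have [->|ne] := eqVneq l (kap N); [left|right].
  rewrite fct_sumE big1 // => j _.
  rewrite fctE /monom_coef eq_sym (inj_eq kapI) ltn_eqF //.
  by rewrite scaler0.
by rewrite fctE /monom_coef (negbTE ne) scaler0.
Qed.

Lemma sum_monom_seq (b : family) (s : seq MI) : uniq s ->
  \sum_(k <- s) b k *: monom_coef k = fun l => if l \in s then b l else 0.
Proof.
move=> us; apply/funext => l; rewrite fct_sumE; case: ifPn => ls.
  rewrite (bigD1_seq l) //= big1 ?addr0 => [|k ne].
    by rewrite fctE /monom_coef eqxx /GRing.scale /= mulr1.
  by rewrite fctE /monom_coef eq_sym (negbTE ne) scaler0.
rewrite big_seq big1 // => k ks; rewrite fctE /monom_coef.
have [E|_] := eqVneq l k; last by rewrite scaler0.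
by rewrite E ks in ls.
Qed.

(** Finite combinations of monomials are dense: the sum defining the norm is a
supremum over finite sets, and truncation to a nearly optimal set leaves the
tail. *)
Lemma truncation (b : family) (e : R) : (N2 b < +oo)%E -> 0 < e ->
  exists s : seq MI, (N2 (b - \sum_(k <- s) b k *: monom_coef k)%R < e%:E)%E.
Proof.
move=> b_fin e_gt0.
have b_num : N2 b \is a fin_num by rewrite ge0_fin_numE // norm2_ge0.
have [_ [A [finA _] <-] ltA] := ub_ereal_sup_adherent e_gt0 b_num.
have /finite_seqP[s0 As] := finA; exists (undup s0).
rewrite sum_monom_seq ?undup_uniq //; set t := (X in b - X).
have t_A : N2 t = (\sum_(k \in A) (weight alpha k * Normc.normc (b k) ^+ 2)%:E)%E.
  rewrite -esum_fset // => [|k _]; last exact: norm2_term_ge0.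
  rewrite esum_mkcond; apply: eq_esum => k _; rewrite /t As.
  rewrite mem_undup; have [kA|kA] := boolP (k \in s0).
    by rewrite ifT //; exact: mem_set.
  rewrite ifF ?Normc.normc0 ?expr0n ?mulr0 //; apply/negbTE.
  by rewrite notin_setE /=; exact/negP.
have b_split : N2 b = (N2 t + N2 (b - t)%R)%E.
  rewrite -norm2D_disjoint ?subrKC // => k; rewrite !fctE /t.
  by case: ifP => _; [right; rewrite subrr | left].
have : (N2 b - e%:E < N2 t)%E by rewrite t_A.
move: b_num; rewrite b_split fin_numD => /andP[].
case: (N2 t) => // x _; case: (N2 (b - t)%R) => // y _.
by rewrite /= !lte_fin; lra.
Qed.

End Coefficients.

Arguments monom_coef {R n} k l.

(** * Approximation by multiples of a binomial *)

Lemma harmonic_unbounded (R : realType) (B : R) :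
  exists N, B < \sum_(j < N) j.+1%:R^-1.
Proof.
apply/not_existsP => bounded; apply: (@dvg_harmonic R).
apply: nondecreasing_is_cvgn; last first.
  exists B => _ [N _ <-]; rewrite /series /= big_mkord leNgt.
  by apply/negP; exact: bounded.
apply/nondecreasing_seqP => N; rewrite /series /= big_nat_recr //= lerDl.
by rewrite invr_ge0.
Qed.

Section Span.
Local Open Scope classical_set_scope.
Variables (R : realType) (n : nat) (alpha : R).
Local Notation MI := (multi_index n).
Local Notation family := (MI -> R[i]).
Local Notation N2 := (@dirichlet_norm2 R n alpha).

(** In the application, [e k] is the coefficient family of [z^k f], so that the
span corresponds to the polynomial multiples of [f]. *)
Definition in_span (e : MI -> family) (a : family) : Prop :=
  exists s : seq (R[i] * MI), a = \sum_(ck <- s) ck.1 *: e ck.2.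

Definition approximable (e : MI -> family) (a : family) : Prop :=
  forall eps : R, 0 < eps -> exists2 h, in_span e h & (N2 (a - h)%R < eps%:E)%E.

Lemma in_span0 e : in_span e 0.
Proof. by exists [::]; rewrite big_nil. Qed.

Lemma in_spanD e a b : in_span e a -> in_span e b -> in_span e (a + b).
Proof. by move=> [s ->] [t ->]; exists (s ++ t); rewrite big_cat. Qed.

Lemma in_spanZ e c a : in_span e a -> in_span e (c *: a).
Proof.
move=> [s ->]; exists [seq (c * ck.1, ck.2) | ck <- s].
by rewrite big_map scaler_sumr; apply: eq_bigr => ck _; rewrite scalerA.
Qed.

Lemma in_span_gen e k : in_span e (e k).
Proof. by exists [:: (1, k)]; rewrite big_seq1 scale1r. Qed.

Lemma in_span_sum e (I : Type) (s : seq I) (F : I -> family) :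
  (forall i, in_span e (F i)) -> in_span e (\sum_(i <- s) F i).
Proof.
move=> spanF; apply: (big_ind (in_span e)) => //; first exact: in_span0.
exact: in_spanD.
Qed.

Lemma approximable0 e : approximable e 0.
Proof.
by move=> eps eps_gt0; exists 0; [exact: in_span0 | rewrite subrr norm2_0 lte_fin].
Qed.

Lemma approximableD e a b :
  approximable e a -> approximable e b -> approximable e (a + b).
Proof.
move=> apa apb eps eps_gt0; have eps4 : 0 < eps / 4 by rewrite divr_gt0.
have [h sh lth] := apa _ eps4; have [g sg ltg] := apb _ eps4.
exists (h + g); first exact: in_spanD.
rewrite opprD addrACA; apply: (le_lt_trans (norm2D _ _ _)).
have -> : eps%:E = ((eps / 4)%:E + (eps / 4)%:E + ((eps / 4)%:E + (eps / 4)%:E))%E.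
  by rewrite -!EFinD; congr _%:E; field.
by rewrite !lteD.
Qed.

Lemma approximable_all e : (forall c k, approximable e (c *: monom_coef k)) ->
  forall b, (N2 b < +oo)%E -> approximable e b.
Proof.
move=> ap b b_fin eps eps_gt0; have eps4 : 0 < eps / 4 by rewrite divr_gt0.
have [s lts] := truncation b_fin eps4.
have : approximable e (\sum_(k <- s) b k *: monom_coef k).
  apply: (big_ind (approximable e)) => //; first exact: approximable0.
  exact: approximableD.
move=> /(_ _ eps4)[h sh lth]; exists h => //.
rewrite -(subrKA (\sum_(k <- s) b k *: monom_coef k)).
apply: (le_lt_trans (norm2D _ _ _)).
have -> : eps%:E = ((eps / 4)%:E + (eps / 4)%:E + ((eps / 4)%:E + (eps / 4)%:E))%E.
  by rewrite -!EFinD; congr _%:E; field.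
by rewrite !lteD.
Qed.

Definition shifted_binomial (c : R[i]) (u k : MI) : family :=
  monom_coef k - c *: monom_coef (k + u).

(** With [x = c z^u], this is the divisibility of [1 - x^j] by [1 - x],
multiplied by [z^k]. *)
Lemma telescope_in_span c u k j :
  in_span (shifted_binomial c u) (monom_coef k - c ^+ j *: monom_coef (k + u *+ j)).
Proof.
elim: j => [|j IH]; first by rewrite mulr0n addr0 scale1r subrr; exact: in_span0.
rewrite -(subrKA (c ^+ j *: monom_coef (k + u *+ j))).
apply: in_spanD => //; rewrite exprSr -scalerA -scalerBr mulrSr addrA.
by apply: in_spanZ; exact: in_span_gen.
Qed.

(** The polynomial [P = (1/H) sum_(j < N) x^j / (j + 1)], where [H] is the
harmonic sum, takes the value [1] at [1]; so [z^k - z^k P(c z^u)] lies in the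
span, and [z^k P(c z^u)] has squared norm at most [K / H]. With the
scalar [c0] included, finite combinations of monomials are reached by addition
alone. *)
Lemma approximable_monom (c : R[i]) (u : MI) (c0 : R[i]) (k : MI) (K : R) :
  u != 0 ->
  (forall j, Normc.normc c ^+ 2 ^+ j * weight alpha (k + u *+ j) <= K * j.+1%:R) ->
  approximable (shifted_binomial c u) (c0 *: monom_coef k).
Proof.
move=> u_neq0 leK eps eps_gt0.
have kapI : injective (fun j => k + u *+ j).
  move=> i j /ffunP eq_ij; apply/eqP; apply: contraNT u_neq0 => ne_ij.
  apply/eqP/ffunP => l; rewrite [RHS]ffunE; have := eq_ij l.
  rewrite !ffunE !ffunMnE -[_ *+ i]mulr_natr -[_ *+ j]mulr_natr !natn => /addnI/eqP.
  by rewrite eqn_mul2l (negbTE ne_ij) orbF => /eqP.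
set B := Normc.normc c0 ^+ 2.
have B_ge0 : 0 <= B by exact: sqr_ge0.
have [N ltN] := harmonic_unbounded (`|B * K| / eps).
set H := \sum_(j < N) _ in ltN.
have H_gt0 : 0 < H by apply: le_lt_trans ltN; rewrite divr_ge0 // ltW.
pose lam j : R := H^-1 * j.+1%:R^-1.
have lam1 : \sum_(j < N) (lam j)%:C = 1.
  by rewrite -raddf_sum /= -mulr_sumr mulVf ?gt_eqF.
(* the approximant is [c0 z^k (1 - P(x))], regrouped so that each term
   telescopes *)
exists (\sum_(j < N) (c0 * (lam j)%:C) *:
    (monom_coef k - c ^+ j *: monom_coef (k + u *+ j))).
  by apply: in_span_sum => j; apply: in_spanZ; exact: telescope_in_span.
have -> : c0 *: monom_coef k -
    \sum_(j < N) (c0 * (lam j)%:C) *: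
      (monom_coef k - c ^+ j *: monom_coef (k + u *+ j)) =
    \sum_(j < N) (c0 * (lam j)%:C * c ^+ j) *: monom_coef (k + u *+ j).
  rewrite (eq_bigr (fun j : 'I_N => (c0 * (lam j)%:C) *: monom_coef k -
      (c0 * (lam j)%:C * c ^+ j) *: monom_coef (k + u *+ j))).
    rewrite sumrB -scaler_suml -mulr_sumr lam1 mulr1 subKr //.
  by move=> j _; rewrite scalerBr scalerA.
rewrite (norm2_sum_monom alpha (fun j => c0 * (lam j)%:C * c ^+ j) N kapI) lte_fin.
apply: (@le_lt_trans _ _ (\sum_(j < N) B * K / H ^+ 2 * j.+1%:R^-1)).
  apply: ler_sum => j _.
  have -> : Normc.normc (c0 * (lam j)%:C * c ^+ j) ^+ 2 =
      B * lam j ^+ 2 * Normc.normc c ^+ 2 ^+ j.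
    rewrite !Normc.normcM 2!exprMn; congr (_ * _ * _).
      by rewrite /= expr0n addr0 sqrtr_sqr real_normK ?num_real.
    elim: (j : nat) => [|i IHi]; first by rewrite !expr0 Normc.normc1 expr1n.
    by rewrite [c ^+ _]exprS Normc.normcM exprMn IHi -exprS.
  rewrite mulrC.
  apply: (@le_trans _ _ (B * lam j ^+ 2 * (K * j.+1%:R))).
    by rewrite -(mulrA (B * _)) ler_wpM2l ?leK //; apply: mulr_ge0 => //;
      exact: sqr_ge0.
  rewrite le_eqVlt; apply/orP; left; apply/eqP; rewrite /lam; field.
  by rewrite nat1r pnatr_eq0 (gt_eqF H_gt0).
rewrite -mulr_sumr -/H.
have -> : B * K / H ^+ 2 * H = B * K / H by field; rewrite gt_eqF.
rewrite ltr_pdivrMr // [ltRHS]mulrC -ltr_pdivrMr //.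
by apply: le_lt_trans ltN; rewrite ler_pM2r ?invr_gt0 // ler_norm.
Qed.

End Span.

(** * Functions on the ball *)

Section PowerSeries.
Local Open Scope classical_set_scope.
Variables (R : realType) (n : nat).
Local Notation MI := (multi_index n).
Local Notation family := (MI -> R[i]).
Local Notation fct := ('rV[R[i]]_n -> R[i]^o).

Local Existing Instance summability.totally_filter.

Lemma power_seriesD (f g : fct) (a b : family) :
  power_series_of f a -> power_series_of g b ->
  power_series_of (fun z => f z + g z) (a + b).
Proof.
move=> fa gb z ballz.
have -> : summability.partial_sum (fun k => (a + b) k * monom k z : R[i]^o) =
    summability.partial_sum (fun k => a k * monom k z : R[i]^o) +
    summability.partial_sum (fun k => b k * monom k z : R[i]^o).
  apply/funext => A; rewrite /summability.partial_sum !addrfctE -big_split /=.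
  by apply: eq_bigr => k _; rewrite mulrDl.
apply: cvgD; [exact: fa | exact: gb].
Qed.

Lemma power_seriesZ (f : fct) (a : family) c :
  power_series_of f a -> power_series_of (fun z => c * f z) (c *: a).
Proof.
move=> fa z ballz.
have -> : summability.partial_sum (fun k => (c *: a) k * monom k z : R[i]^o) =
    c *: (summability.partial_sum (fun k => a k * monom k z : R[i]^o)).
  apply/funext => A; rewrite /summability.partial_sum !scalrfctE scaler_sumr.
  by apply: eq_bigr => k _; rewrite -scalerAl.
apply: cvgZr; exact: fa.
Qed.

(** The partial sums are constant on the finite sets that contain [k]. *)
Lemma power_series_monom k : power_series_of (monom k : fct) (monom_coef k).
Proof.
move=> z _; apply: cvg_near_cst; exists (fset1 k) => // A /= /fsubsetP kA.
have {}kA : k \in A by apply: kA; rewrite in_fset1.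
rewrite /summability.partial_sum (bigD1 (FSetSub kA)) //= big1 => [|l ne_lk].
  by rewrite addr0 /monom_coef eqxx mul1r.
rewrite /monom_coef (_ : (\val l == k) = false) ?mul0r //.
by apply: contraNF ne_lk => /eqP lk; apply/eqP/val_inj.
Qed.

Lemma monomD (k l : MI) (z : 'rV[R[i]]_n) : monom (k + l) z = monom k z * monom l z.
Proof. by rewrite /monom -big_split; apply: eq_bigr => i _; rewrite ffunE exprD. Qed.

Lemma monom0 (z : 'rV[R[i]]_n) : monom (0 : MI) z = 1.
Proof. by rewrite /monom big1 // => i _; rewrite ffunE expr0. Qed.

Lemma monom_first_units m (z : 'rV[R[i]]_n) :
  monom (first_units n m) z = \prod_(i < n | (i < m)%N) z 0 i.
Proof.
rewrite /monom [RHS]big_mkcond; apply: eq_bigr => i _.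
by rewrite ffunE; case: ifP.
Qed.

Lemma power_series_binomial (c : R[i]) (u k : MI) :
  power_series_of (fun z => monom k z * (1 - c * monom u z) : R[i]^o)
    (shifted_binomial c u k).
Proof.
rewrite (_ : (fun z => _) = (fun z => monom k z + (- c) * monom (k + u) z : R[i]^o)).
  rewrite /shifted_binomial -scaleNr.
  apply: power_seriesD; first exact: power_series_monom.
  by apply: power_seriesZ; exact: power_series_monom.
by apply/funext => z; rewrite monomD mulrBr mulr1 mulrCA mulNr.
Qed.

Lemma power_series_span (f : fct) (e : MI -> family) (s : seq (R[i] * MI)) :
  (forall k, power_series_of (fun z => monom k z * f z : R[i]^o) (e k)) ->
  power_series_of (fun z => \sum_(ck <- s) ck.1 * (monom ck.2 z * f z) : R[i]^o)
    (\sum_(ck <- s) ck.1 *: e ck.2).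
Proof.
move=> fe; elim: s => [|ck s IHs].
  rewrite big_nil (_ : (fun z => _) = fun z => 0 * (monom 0 z * f z)).
    by rewrite -(scale0r (e 0)); apply: power_seriesZ; exact: fe.
  by apply/funext => z; rewrite big_nil mul0r.
rewrite big_cons (_ : (fun z => _) = (fun z => ck.1 * (monom ck.2 z * f z) +
    \sum_(ck <- s) ck.1 * (monom ck.2 z * f z) : R[i]^o)).
  exact: (power_seriesD (power_seriesZ (c := ck.1) (fe ck.2)) IHs).
by apply/funext => z; rewrite big_cons.
Qed.

Lemma monom_differentiable (u : MI) (z : 'rV[R[i]^o]_n) :
  differentiable (monom u : 'rV[R[i]^o]_n -> R[i]^o) z.
Proof.
have coordX (i : 'I_n) j :
    differentiable (fun w : 'rV[R[i]^o]_n => w 0 i ^+ j : R[i]^o) z.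
  elim: j => [|j IHj]; first exact: differentiable_cst.
  rewrite (_ : (fun w => _) = (fun w : 'rV[R[i]^o]_n => w 0 i : R[i]^o) *
     (fun w : 'rV[R[i]^o]_n => w 0 i ^+ j : R[i]^o)).
    by apply: differentiableM => //; exact: differentiable_coord.
  by apply/funext => w; rewrite exprS.
rewrite /monom; elim: (index_enum _) => [|i s IHs].
  by rewrite (_ : (fun w => _) = cst 1) //; apply/funext => w; rewrite big_nil.
rewrite (_ : (fun w => _) = (fun w : 'rV[R[i]^o]_n => w 0 i ^+ u i : R[i]^o) *
   (fun w : 'rV[R[i]^o]_n => \prod_(i <- s) w 0 i ^+ u i : R[i]^o)).
  exact: differentiableM.
by apply/funext => w; rewrite big_cons.
Qed.

Lemma binomial_holomorphic (c : R[i]) (u : MI) :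
  holomorphic_on_ball (fun z => 1 - c * monom u z : R[i]^o).
Proof.
move=> z _.
have dp : differentiable
    (cst (1 : R[i]^o) - c *: (monom u : 'rV[R[i]^o]_n -> R[i]^o)) z.
  apply: differentiableB; first exact: differentiable_cst.
  by apply: differentiableZ; exact: monom_differentiable.
exact: dp.
Qed.

(** Cyclicity only depends on the coefficient families: if [g] has coefficients
[b] and [h] is the polynomial multiple of [f] built from the approximant of [b],
then [g - h] has the difference as its coefficients. *)
Lemma cyclic_of_approximable (alpha : R) (f : fct) (e : MI -> family) :
  holomorphic_on_ball f ->
  (forall k, power_series_of (fun z => monom k z * f z : R[i]^o) (e k)) ->
  (dirichlet_norm2 alpha (e 0%R) < +oo)%E ->
  (forall c k, approximable alpha e (c *: monom_coef k)) ->
  cyclic_vector alpha f.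
Proof.
move=> f_hol f_e e_fin ap; split.
  split=> //; exists (e 0); split=> //.
  rewrite (_ : f = fun z => monom 0 z * f z) //.
  by apply/funext => z; rewrite monom0 mul1r.
apply/seteqP; split=> [g []//|g g_dir]; split=> // eps eps_gt0.
have [_ [b [g_b b_fin]]] := g_dir.
have eps2 : 0 < eps ^+ 2 by rewrite exprn_gt0.
have [_ [s ->] lts] := approximable_all ap b_fin eps2.
exists (fun z => \sum_(ck <- s) ck.1 * (monom ck.2 z * f z)); first by exists s.
exists (b - \sum_(ck <- s) ck.1 *: e ck.2); split; last exact: lts.
rewrite -scaleN1r (_ : (fun z => _) =
    (fun z => g z + (-1) * \sum_(ck <- s) ck.1 * (monom ck.2 z * f z))).
  exact: (power_seriesD g_b (power_seriesZ (c := -1) (power_series_span (s := s) f_e))).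
by apply/funext => z; rewrite mulN1r.
Qed.

End PowerSeries.

Unset Implicit Arguments.

Theorem theorem11 (R : realType) (n m : nat) (hm1 : (1 <= m)%N) (hmn : (m <= n)%N)
  (alpha : R) (halpha : alpha <= (2 * n%:R + 1 - m%:R) / 2) :
  cyclic_vector alpha
    (fun z : 'rV[R[i]]_n =>
       1 - (m%:R `^ (m%:R / 2))%:C * \prod_(i < n | (i < m)%N) z 0 i).
Proof.
case: m hm1 hmn halpha => [//|m _ lt_mn le_alpha].
have n_gt0 : (0 < n)%N by lia.
set c := (_ `^ _)%:C; set u := first_units n m.+1.
have -> : (fun z : 'rV[R[i]]_n => 1 - c * \prod_(i < n | (i < m.+1)%N) z 0 i) =
    fun z => 1 - c * monom u z.
  by apply/funext => z; rewrite monom_first_units.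
have normc_c : Normc.normc c ^+ 2 = (m.+1 ^ m.+1)%:R.
  rewrite /= expr0n addr0 sqrtr_sqr real_normK ?num_real //.
  by rewrite -powR_mulrn ?powR_ge0 // -powRrM mulfVK ?pnatr_eq0 // powR_mulrn ?natrX.
have u_neq0 : u != 0.
  apply/eqP => /ffunP /(_ (Ordinal n_gt0)); rewrite !ffunE //.
apply: (cyclic_of_approximable (@binomial_holomorphic R n c u)
  (@power_series_binomial R n c u)).
  rewrite /shifted_binomial -scaleNr -[X in X + _]scale1r.
  apply: le_lt_trans (norm2D _ _ _) _.
  by rewrite !norm2_monom -!EFinD ltry.
move=> c0 k; set beta : R := (2 * n%:R - m%:R) / 2.
have le_ab : alpha <= beta.
  by apply: le_trans le_alpha _; rewrite /beta -[m.+1]addn1 natrD; lra.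
have beta_ge0 : 0 <= beta.
  by rewrite divr_ge0 // subr_ge0 -natrM ler_nat; lia.
have [K K_ge0 leK] := @weight_diagonal_bound R n m lt_mn.
(* the shift by [k] is applied at [beta], because [weightD] requires a
   nonnegative exponent *)
have [L L_ge0 leL] := weightD k n_gt0 beta_ge0.
apply: (@approximable_monom _ _ _ c u c0 k (L * K)) => // j.
rewrite normc_c addrC -(mulrA L).
apply: le_trans (ler_wpM2l L_ge0 (leK j)).
rewrite [leRHS]mulrCA ler_wpM2l ?exprn_ge0 //.
exact: le_trans (le_weight _ n_gt0 le_ab) (leL _).
Qed.
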